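(* Let $p$ be a prime, $q=p^l$, $m\ge1$, $n=2m$. For any $r$ with $0\leqslant r<n(q-1)$ and any $I\subseteq M_r$, with $\overline{I}=M_r\setminus I$, \begin{align*} \dim(\mathcal{C}_q(r,I,n))&=\sum_{i=0}^n(-1)^i\binom{n}{i}\binom{n+r-iq}{r-iq}\\ &\quad-2\sum_{k\in\overline{I},\,k\neq0}\left(\sum_{i=0}^{m}(-1)^i\binom{m}{i}\binom{\frac{n(q-1)-r-k}{2}-iq+m-1}{\frac{n(q-1)-r-k}{2}-iq}\right)\left(\sum_{i=0}^{m}(-1)^i\binom{m}{i}\binom{\frac{n(q-1)-r+k}{2}-iq+m-1}{\frac{n(q-1)-r+k}{2}-iq}\right)\\ &\quad-\mathbf{1}_{\overline{I}}(0)\left(\sum_{i=0}^{m}(-1)^i\binom{m}{i}\binom{\frac{n(q-1)-r}{2}-iq+m-1}{\frac{n(q-1)-r}{2}-iq}\right)^2, \end{align*} where $\mathbf{1}_{\overline{I}}(0)=1$ if $0\in\overline{I}$ and $0$ otherwise.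
   Context: Let $N=q^n-1$ and $\alpha$ a primitive element of $\mathbb{F}_{q^n}$. Every integer $0\le u\le q^n-1$ is written $u=\sum_{i=0}^{n-1}u_iq^i$, $u_i\in\{0,\dots,q-1\}$; $\mathrm{wt}_q(u)=\sum u_i$, $O(u)=\sum_{i\text{ odd}}u_i$, $E(u)=\sum_{i\text{ even}}u_i$. For $-1\le r<n(q-1)$, $Z_r=\{\alpha^u\mid 0<u\le q^n-1,\ \mathrm{wt}_q(u)\le n(q-1)-r-1\}$. For $0\le r\le n(q-1)$ and integer $k\ge0$, $\Theta^{(r)}_k=\{\alpha^u\mid 0\le u\le q^n-1,\ \mathrm{wt}_q(u)=n(q-1)-r,\ |O(u)-E(u)|=k\}$. $M_r$ is the set of even (resp. odd) integers $k\in[0,m(q-1)]$ when $r$ is even (resp. odd). For $I\subseteq M_r$, $\overline I=M_r\setminus I$ and $Z_{r,I}=Z_r\cup\bigcup_{k\in\overline I}\Theta^{(r)}_k$. A cyclic code of length $N$ over $\mathbb{F}_q$ with zero set $Z\subseteq\mathbb{F}_{q^n}^*$ is $\{(c_0,\dots,c_{N-1})\in\mathbb{F}_q^N\mid \sum_{i=0}^{N-1}c_i\beta^i=0\ \forall\beta\in Z\}$. $\mathcal{C}_q(r,I,n)^*$ is the cyclic code with zero set $Z_{r,I}$, and $\mathcal{C}_q(r,I,n)\subseteq\mathbb{F}_q^{q^n}$ is its extended code, obtained by appending to each codeword $c$ the coordinate $-\sum_{i}c_i$. Binomial coefficients $\binom ab$ with $b<0$ are $0$. *)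

(* Defs.v *)
From HB Require Import structures.
From mathcomp Require Import all_boot all_order all_algebra all_field.
Set Implicit Arguments. Unset Strict Implicit. Unset Printing Implicit Defensive.
Import Order.TTheory GRing.Theory Num.Theory.

Definition qdigit (q i u : nat) : nat := (u %/ q ^ i) %% q.
Definition wtq (q n u : nat) : nat := \sum_(i < n) qdigit q i u.
Definition Odig (q n u : nat) : nat := \sum_(i < n | odd i) qdigit q i u.
Definition Edig (q n u : nat) : nat := \sum_(i < n | ~~ odd i) qdigit q i u.

(* alpha^u in Z_r *)
Definition inZr (q n r u : nat) : bool :=
  [&& 0 < u, u <= q ^ n - 1 & wtq q n u + r + 1 <= n * (q - 1)].
(* alpha^u in Theta^(r)_k : wt = n(q-1)-r and |O(u)-E(u)| = k *)
Definition inTheta (q n r k u : nat) : bool :=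
  [&& u <= q ^ n - 1, wtq q n u + r == n * (q - 1) &
      (Odig q n u + k == Edig q n u) || (Edig q n u + k == Odig q n u)].
Definition Mr (q m r k : nat) : bool := (k <= m * (q - 1)) && (odd k == odd r).
Definition Ibar (q m r : nat) (I : pred nat) (k : nat) : bool :=
  Mr q m r k && ~~ I k.
Definition inZrI (q m r : nat) (I : pred nat) (u : nat) : bool :=
  inZr q (2 * m) r u ||
  [exists k : 'I_(m * (q - 1)).+1, Ibar q m r I k && inTheta q (2 * m) r k u].

Section Codes.
Variables (K : finFieldType) (L : fieldExtType K).

Definition evalw (N : nat) (beta : L) (c : 'rV[K]_N) : L :=
  (\sum_(i < N) c 0 i *: beta ^+ i)%R.

(* cyclic code of length N over K with zero set {beta | Z beta}, given as
   the alpha^u, u <= N, satisfying the predicate Zu *)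
Definition cyclic_code (N : nat) (alpha : L) (Zu : pred nat)
  : {vspace 'rV[K]_N} :=
  (\bigcap_(u < N.+1 | Zu u) lker (linfun (evalw (alpha ^+ u))))%VS.

Definition extend (N : nat) (c : 'rV[K]_N) : 'rV[K]_(N + 1) :=
  row_mx c (\row_(j < 1) (- \sum_(i < N) c 0 i)%R).

Definition extended_code (N : nat) (C : {vspace 'rV[K]_N})
  : {vspace 'rV[K]_(N + 1)} := (linfun (@extend N) @: C)%VS.

Definition Cq (q m r : nat) (I : pred nat) (alpha : L)
  : {vspace 'rV[K]_(q ^ (2 * m) - 1 + 1)} :=
  extended_code (cyclic_code (q ^ (2 * m) - 1) alpha (inZrI q m r I)).
End Codes.

Definition binz (a b : int) : int :=
  match b with
  | Negz _ => 0%R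
  | Posz b' => match a with
               | Posz a' => ('C(a', b'))%:Z
               | Negz a' => ((-1) ^+ b' * ('C(a' + b', b'))%:Z)%R
               end
  end.

(* Main.v *)
(* The code of length N = q^n - 1 with zeros alpha^u, u in Z, consists of the
   multiples of g = \prod_(u in Z) (X - alpha^u).  The Frobenius x |-> x^q maps
   alpha^u to alpha^v with v the cyclic shift of the base-q digits of u; since n
   is even the shift swaps O(u) and E(u), hence preserves Z, so g has
   coefficients in F_q and the dimension is N - #|Z|.  The exponents u are then
   counted by generating functions: the coefficient of X^x in
   ((1 - X^q) / (1 - X))^m counts the m-tuples of digits with sum x, and the pair
   (O(u), E(u)) has the product of two such series as generating function. *)
Require Import Defs.
From HB Require Import structures.
From mathcomp Require Import all_boot all_order all_algebra all_field.
From mathcomp Require Import zify ring.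
Import Order.TTheory GRing.Theory Num.Theory.
Local Open Scope ring_scope.

(** * Dimension of cyclic codes *)

Section CyclicCodeDimension.

Context {K : finFieldType} {L : fieldExtType K}.
Implicit Types (N : nat) (alpha : L) (Z : pred nat).

Lemma evalw_is_linear N (b : L) : linear (@evalw K L N b).
Proof.
move=> a u v; rewrite /evalw scaler_sumr -big_split; apply: eq_bigr => i _ /=.
by rewrite !mxE scalerDl scalerA.
Qed.
HB.instance Definition _ N (b : L) :=
  GRing.isLinear.Build K 'rV[K]_N L _ (@evalw K L N b) (evalw_is_linear N b).

Lemma extend_is_linear N : linear (@extend K N).
Proof.
move=> a u v; rewrite /extend scale_row_mx add_row_mx; congr row_mx.
apply/rowP=> j; rewrite !mxE mulrN mulr_sumr -opprD -big_split; congr (- _).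
by apply: eq_bigr => i _; rewrite !mxE.
Qed.
HB.instance Definition _ N :=
  GRing.isLinear.Build K 'rV[K]_N 'rV[K]_(N + 1) _ (@extend K N)
    (extend_is_linear N).

Lemma dim_extended_code N (C : {vspace 'rV[K]_N}) :
  \dim (extended_code C) = \dim C.
Proof.
rewrite /extended_code limg_dim_eq //; apply/eqP; rewrite -subv0.
apply: subv_trans (capvSr _ _) _; rewrite subv0; apply/lker0P => u v.
by rewrite !lfunE => /eq_row_mx [].
Qed.

Definition frobenius (x : L) := x ^+ #|K|.

(** [#|K|] is a power of the characteristic of [L], so raising to it respects sums. *)
Lemma frobenius_is_zmod_morphism : zmod_morphism frobenius.
Proof.
have [p pr_p pK] := finPcharP K.
have pL : p \in [pchar L] by rewrite pchar_lalg.
have cardK : [pchar L].-nat #|K|.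
  rewrite (eq_pnat _ (pcharf_eq pL)).
  have -> : #|K| = (p ^ logn p #|K|)%N := card_pprimeChar pK.
  by rewrite pnatX pnat_id.
move=> x y; apply/eqP; rewrite /frobenius eq_sym subr_eq -exprDn_pchar //.
by rewrite subrK.
Qed.

Lemma frobenius_is_monoid_morphism : monoid_morphism frobenius.
Proof. by split=> [|x y]; rewrite /frobenius (expr1n, exprMn). Qed.

HB.instance Definition _ :=
  GRing.isZmodMorphism.Build L L frobenius frobenius_is_zmod_morphism.
HB.instance Definition _ :=
  GRing.isMonoidMorphism.Build L L frobenius frobenius_is_monoid_morphism.

(** Over [K] the polynomial [X^#|K| - X] is the product of all [X - a], so its roots in [L] are the
    scalars. *)
Lemma frobenius_fixed (x : L) : frobenius x = x -> x \in 1%VS.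
Proof.
move=> xq; suff: root (map_poly (in_alg L) ('X^#|K| - 'X)) x.
  rewrite finField_genPoly map_prod_XsubC -big_enum.
  rewrite -(big_map (in_alg L) xpredT (fun a => 'X - a%:P)) root_prod_XsubC.
  by case/mapP=> a _ ->; rewrite rpredZ ?mem1v.
rewrite rmorphB /= map_polyXn map_polyX rootE !hornerE -/(frobenius x) xq.
by rewrite subrr.
Qed.

Lemma evalwE N (b : L) (c : 'rV[K]_N) :
  evalw b c = (map_poly (in_alg L) (rVpoly c)).[b].
Proof.
rewrite (@horner_coef_wide _ N) ?size_map_poly ?size_poly // /evalw.
apply: eq_bigr => i _.
by rewrite coef_map coef_rVpoly_ord /= mulr_algl.
Qed.

Lemma mem_cyclic_code N alpha Z (c : 'rV[K]_N) :
  reflect (forall u : 'I_N.+1, Z u -> evalw (alpha ^+ u) c = 0)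
          (c \in cyclic_code N alpha Z).
Proof.
rewrite memvE; apply: (iffP subv_bigcapP) => H u Zu.
  by have := H u Zu; rewrite -memvE memv_ker lfunE => /eqP.
by rewrite -memvE memv_ker lfunE /= H.
Qed.

(** Multiplication by [g] is injective and maps the polynomials of size at most [N - deg g] onto the
    code. *)
Lemma dim_multiples N (g : {poly K}) (C : {vspace 'rV[K]_N}) :
  g != 0 -> ((size g).-1 <= N)%N ->
  (forall c, (c \in C) = (g %| rVpoly c)) -> \dim C = (N - (size g).-1)%N.
Proof.
move=> g0 sgN memC; set d := (N - _)%N.
pose f (v : 'rV[K]_d) : 'rV[K]_N := poly_rV (rVpoly v * g).
have fE v : rVpoly (f v) = rVpoly v * g.
  rewrite poly_rV_K //; have [->|v0] := eqVneq (rVpoly v) 0.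
    by rewrite mul0r size_poly0.
  rewrite size_mul // -subn1 -addnBA ?size_poly_gt0 // subn1.
  apply: leq_trans (_ : d + (size g).-1 <= N)%N; last by rewrite /d subnK.
  by rewrite leq_add2r size_poly.
have flin : linear f.
  by move=> a u v; rewrite /f !linearP mulrDl -scalerAl linearP.
pose fl := HB.pack_for {linear 'rV[K]_d -> 'rV[K]_N} f
  (GRing.isLinear.Build K _ _ _ f flin).
have finj : injective (linfun fl).
  move=> u v; rewrite !lfunE /= => /(congr1 rVpoly); rewrite !fE => /(mulIf g0).
  exact: (can_inj rVpolyK).
have sgg : (size g = (size g).-1.+1)%N by rewrite prednK // size_poly_gt0.
have -> : C = limg (linfun fl).
  apply/vspaceP=> c; rewrite memC; apply/dvdpP/memv_imgP => [[h ch]|[v _ ->]].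
    have sh : (size h <= d)%N.
      have [->|h0] := eqVneq h 0; first by rewrite size_poly0.
      have : (size (rVpoly c) <= N)%N by exact: size_poly.
      by rewrite ch size_mul // sgg addnS /= addnC leq_subRL.
    exists (poly_rV h); rewrite ?memvf // lfunE /= -[LHS]rVpolyK ch.
    by rewrite /f poly_rV_K.
  by exists (rVpoly v); rewrite lfunE -fE.
rewrite limg_dim_eq ?dimvf; first by rewrite /dim /= mul1n.
apply/eqP; rewrite -subv0; apply: subv_trans (capvSr _ _) _.
by rewrite subv0; apply/lker0P.
Qed.


(** The map [sg] realises the Frobenius on the exponents in [Z]; this brings the generator down to
    [K]. Its degree is the number of exponents. *)
Lemma dim_cyclic_code N alpha Z (sg : 'I_N.+1 -> 'I_N.+1) :
  N.-primitive_root alpha -> ~~ Z 0%N -> injective sg ->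
  (forall u : 'I_N.+1, Z (sg u) = Z u) ->
  (forall u : 'I_N.+1, alpha ^+ sg u = alpha ^+ (u * #|K|)) ->
  \dim (cyclic_code N alpha Z : {vspace 'rV[K]_N})
    = (N - \sum_(u < N.+1) Z u)%N.
Proof.
move=> prim Z0 sg_inj Zsg alpha_sg.
pose rs := [seq alpha ^+ u | u : 'I_N.+1 <- enum 'I_N.+1 & Z u].
pose g := \prod_(z <- rs) ('X - z%:P).
have gE : g = \prod_(u < N.+1 | Z u) ('X - (alpha ^+ u)%:P).
  by rewrite /g big_map big_filter big_enum_cond.
have szrs : size rs = (\sum_(u < N.+1) Z u)%N.
  by rewrite size_map size_filter -sum1_count -big_mkcondr big_enum_cond.
(* Among the exponents from 0 to [N] only 0 and [N] agree modulo [N], and [Z] excludes 0. *)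
have Nrs : uniq rs.
  rewrite map_inj_in_uniq => [|u v]; first exact/filter_uniq/enum_uniq.
  rewrite !mem_filter => /andP[Zu _] /andP[Zv _] /eqP.
  have pos (w : 'I_N.+1) : Z w -> (0 < w)%N.
    by case: (posnP w) => // ->; rewrite (negPf Z0).
  rewrite (eq_prim_root_expr prim) => /eqP uv; apply/val_inj => /=.
  have uN := ltn_ord u; have vN := ltn_ord v; rewrite !ltnS in uN vN.
  have N0 := prim_order_gt0 prim.
  have nz (w : 'I_N.+1) : (w < N)%N -> Z w -> (w %% N != 0)%N.
    by move=> wN /pos; rewrite modn_small // -lt0n.
  case: (ltngtP u N) uN => // uN _; case: (ltngtP v N) vN => // vN _.
  - by rewrite !modn_small in uv.
  - by move: (nz u uN Zu); rewrite uv vN modnn.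
  - by move: (nz v vN Zv); rewrite -uv uN modnn.
  - by rewrite uN vN.
(* The Frobenius permutes the linear factors of [g], hence fixes each coefficient. *)
have : g \is a polyOver 1%VS.
  apply/polyOverP => i; apply: frobenius_fixed; rewrite -coef_map /=.
  congr (polyseq _)`_i; rewrite gE map_prod_XsubC /=.
  rewrite [RHS](reindex_inj sg_inj) /=.
  apply: eq_big => u //= _.
  by rewrite alpha_sg exprM.
case/polyOver1P => gK gKE.
have szg : (size gK).-1 = size rs.
  by rewrite -(size_map_poly (in_alg L)) -gKE size_prod_XsubC.
rewrite -szrs -szg; apply: dim_multiples.
- by rewrite -(map_poly_eq0 (in_alg L)) -gKE monic_neq0 ?monic_prod_XsubC.
- rewrite szg szrs big_ord_recl /= (negPf Z0) add0n.
  rewrite -[X in (_ <= X)%N]card_ord -sum1_card leq_sum // => i _; by case: (Z _).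
(* Divisibility can be tested over [L], where [g] splits into distinct linear factors. *)
move=> c; rewrite -(dvdp_map (in_alg L)) -gKE.
apply/idP/idP => [/mem_cyclic_code H|/dvdpP[h hE]].
  apply: uniq_roots_dvdp; rewrite ?uniq_rootsE //.
  apply/allP => z /mapP[u]; rewrite mem_filter => /andP[Zu _] ->.
  by rewrite rootE -evalwE H.
apply/mem_cyclic_code => u Zu; rewrite evalwE hE hornerM; apply/eqP.
rewrite mulf_eq0 -!rootE.
rewrite root_prod_XsubC; apply/orP; right.
by apply: (map_f (fun v : 'I__ => alpha ^+ v)); rewrite mem_filter Zu mem_enum.
Qed.
End CyclicCodeDimension.

(** * Base-q digits *)

(** Rotation of the [n] base-[q] digits, top digit to the bottom. Unlike the residue of [u * q]
    modulo [q ^ n - 1], it fixes [q ^ n - 1], so it is injective below [q ^ n]. *)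
Definition cyclic_shift (q n u : nat) : nat :=
  (u %% q ^ n.-1 * q + u %/ q ^ n.-1)%N.

Section Digits.
Local Open Scope nat_scope.
Context {q : nat}.
Hypothesis q_gt0 : 0 < q.

Lemma qdigitS i u : qdigit q i.+1 u = qdigit q i (u %/ q).
Proof. by rewrite /qdigit expnS divnMA. Qed.

Lemma qdigit_inj n u v : u < q ^ n -> v < q ^ n ->
  (forall i, i < n -> qdigit q i u = qdigit q i v) -> u = v.
Proof.
elim: n u v => [|n IHn] u v; first by rewrite expn0; case: u; case: v.
rewrite expnSr -!ltn_divLR // => un vn uv; rewrite (divn_eq u q) (divn_eq v q).
have := uv 0 isT; rewrite /qdigit expn0 !divn1 => ->; congr (_ * q + _).
by apply: IHn => // i ltin; rewrite -!qdigitS uv.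
Qed.

Section Shift.
Context {n u : nat}.
Hypotheses (n_gt0 : 0 < n) (lt_u : u < q ^ n).

Let top_lt : u %/ q ^ n.-1 < q.
Proof. by rewrite ltn_divLR ?expn_gt0 ?q_gt0 // -expnS prednK. Qed.

Lemma cyclic_shift_lt : cyclic_shift q n u < q ^ n.
Proof.
rewrite -(prednK n_gt0) expnSr /cyclic_shift /=.
have : u %% q ^ n.-1 < q ^ n.-1 by rewrite ltn_mod expn_gt0 q_gt0.
move=> lt_m; apply: leq_trans (_ : (u %% q ^ n.-1).+1 * q <= _).
  by rewrite mulSn addnC ltn_add2r.
by rewrite leq_mul2r lt_m orbT.
Qed.

Lemma qdigit_cyclic_shift i :
  i < n -> qdigit q (i.+1 %% n) (cyclic_shift q n u) = qdigit q i u.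
Proof.
move=> ltin; have [eq_in|lt_in] : i.+1 = n \/ i.+1 < n.
- by apply/predU1P; rewrite -leq_eqVlt.
- by rewrite eq_in modnn /qdigit /cyclic_shift expn0 divn1 modnMDl -eq_in.
rewrite modn_small // qdigitS /cyclic_shift divnMDl // (divn_small top_lt) addn0.
rewrite /qdigit modn_divl -expnS modn_dvdm ?modn_divl -?expnS //.
by rewrite dvdn_exp2l // -ltnS prednK.
Qed.

(** In [u * q] the top digit of [u] is multiplied by [q ^ n], which is 1 modulo [q ^ n - 1]. *)
Lemma cyclic_shift_mod :
  cyclic_shift q n u = u * q %[mod q ^ n - 1].
Proof.
rewrite [in RHS](divn_eq u (q ^ n.-1)) mulnDl -mulnA -expnSr prednK //.
have -> : q ^ n = (q ^ n - 1) + 1 by rewrite subnK // expn_gt0 q_gt0.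
rewrite addnK mulnDr muln1 -addnA modnMDl /cyclic_shift.
by rewrite addnC.
Qed.
End Shift.

Lemma cyclic_shift_inj {n} : 0 < n ->
  {in [pred u | u < q ^ n] &, injective (cyclic_shift q n)}.
Proof.
move=> n_gt0 u v lt_u lt_v uv; apply: (@qdigit_inj n) => // i ltin.
by rewrite -(qdigit_cyclic_shift n_gt0 lt_u) // uv qdigit_cyclic_shift.
Qed.

(** As [n] is even, [i] and [i.+1 %% n] have opposite parity, also at the wrap-around. *)
Lemma sum_parity_cyclic_shift m u b (n := 2 * m) : 0 < m -> u < q ^ n ->
  \sum_(i < n | odd i == b) qdigit q i (cyclic_shift q n u)
    = \sum_(i < n | odd i == ~~ b) qdigit q i u.
Proof.
move=> m_gt0 lt_u; have n_gt0 : 0 < n by rewrite muln_gt0.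
rewrite (reindex_inj (@ordS_inj n)); apply: eq_big => i /=.
  by rewrite odd_mod ?oddM //=; case: (odd i); case: b.
by move=> _; rewrite qdigit_cyclic_shift.
Qed.

End Digits.

(** Digit expansion is injective between sets of equal size, hence a bijection onto digit tuples;
    distributivity then factors the sum. *)
Lemma prod_sum_qdigit (R : comPzSemiRingType) (q n : nat)
    (F : 'I_n -> nat -> R) : (0 < q)%N ->
  \sum_(u < q ^ n) \prod_(i < n) F i (qdigit q i u)
   = \prod_(i < n) \sum_(j < q) F i j.
Proof.
case: q => // q _.
pose dg (u : 'I_(q.+1 ^ n)) := [ffun i : 'I_n => inZp (u %/ q.+1 ^ i) : 'I_q.+1].
have dg_inj : injective dg.
  move=> u v /ffunP uv; apply/val_inj.
  apply: (@qdigit_inj q.+1 _ n) => [//|||i ltin]; rewrite ?ltn_ord //.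
  by have /(congr1 val) := uv (Ordinal ltin); rewrite !ffunE.
rewrite bigA_distr_bigA (reindex dg) /=.
  by apply: eq_bigr => u _; apply: eq_bigr => i _; rewrite ffunE.
by apply: onW_bij; apply: inj_card_bij; rewrite // card_ffun !card_ord.
Qed.

(** * Restricted compositions *)

Section TruncatedSeries.
Context {M : nat}.
Implicit Types P Q R : {poly int}.

(** Power series are modelled by polynomials compared in degrees below [M]. *)
Definition eq_upto P Q := forall x, (x < M)%N -> P`_x = Q`_x.

Lemma eq_uptoM {P Q} R : eq_upto P Q -> eq_upto (P * R) (Q * R).
Proof.
move=> PQ x ltxM; rewrite !coefM; apply: eq_bigr => i _.
by rewrite PQ // (leq_ltn_trans _ ltxM) // -ltnS ltn_ord.
Qed.

(** The truncation of [(1 - X)^(-s)]. The truncated predecessor makes [s = 0] correct too: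
    ['C(0, 0)] is 1 and ['C(j.-1, j)] is 0 for positive [j]. *)
Definition inv_series s : {poly int} := \poly_(j < M) ('C((j + s).-1, j))%:Z.

(** On coefficients this is Pascal's rule. *)
Lemma inv_seriesS s : eq_upto (inv_series s.+1 * (1 - 'X)) (inv_series s).
Proof.
move=> x ltxM; rewrite mulrBr mulr1 coefB coefMX !coef_poly ltxM.
case: x ltxM => [|x] ltxM; first by rewrite !bin0 subr0.
rewrite /= (ltnW ltxM) !addnS /= binS. lia.
Qed.

Lemma inv_seriesP s : eq_upto (inv_series s * (1 - 'X) ^+ s) 1.
Proof.
elim: s => [|s IHs] x ltxM.
  rewrite mulr1 coef_poly ltxM coef1.
  by case: x ltxM => [|x] _; rewrite ?bin0 // addn0 bin_small.
by rewrite exprS mulrA (eq_uptoM _ (inv_seriesS s)) // IHs.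
Qed.

Lemma coef_quotient {s P Q} : eq_upto (Q * (1 - 'X) ^+ s) P ->
  eq_upto Q (P * inv_series s).
Proof.
move=> QP x ltxM; rewrite -(eq_uptoM _ QP) // -mulrA [Q * _]mulrC.
by rewrite [_ ^+ s * _]mulrC (eq_uptoM _ (inv_seriesP s)) // mul1r.
Qed.
End TruncatedSeries.

(** As [s] is positive, a negative upper argument comes only with a negative lower one, where [binz]
    is 0. *)
Lemma binzE (x y s : nat) : (0 < s)%N ->
  binz (x%:Z - y%:Z + s%:Z - 1) (x%:Z - y%:Z)
    = if (x < y)%N then 0 else ('C((x - y + s).-1, x - y))%:Z.
Proof.
move=> s_gt0; case: ltnP => [ltxy|leyx].
  by have -> : x%:Z - y%:Z = Negz (y - x).-1 by lia.
have -> : x%:Z - y%:Z + s%:Z - 1 = Posz (x - y + s).-1 by lia.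
by have -> : x%:Z - y%:Z = Posz (x - y) by lia.
Qed.

(** Expanding [(1 - X^q)^m] by the binomial theorem, the term of index [i] shifts the series of
    [(1 - X)^(-s)] by [i * q]. *)
Lemma coef_quotient_binz (q m s x : nat) (Q : {poly int}) : (0 < s)%N ->
  @eq_upto x.+1 (Q * (1 - 'X) ^+ s) ((1 - 'X^q) ^+ m) ->
  Q`_x = \sum_(i < m.+1) (-1) ^+ i * ('C(m, i))%:Z *
     binz (x%:Z - (i * q)%:Z + s%:Z - 1) (x%:Z - (i * q)%:Z).
Proof.
move=> s_gt0 QE; rewrite (coef_quotient QE) //.
rewrite exprBn mulr_suml coef_sum; apply: eq_bigr => i _.
rewrite expr1n mulr1 -exprM (mulnC q) binzE //.
have -> : (-1) ^+ i = ((-1) ^+ i)%:P :> {poly int} by rewrite rmorphXn rmorphN1.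
rewrite -mulrnAr -!mulrA coefCM mulrnAl coefMn coefXnM coef_poly -mulr_natl natz.
case: ltnP => // lex; rewrite ifT //.
by rewrite ltnS leq_subr.
Qed.

Definition digit_series (q : nat) : {poly int} := \sum_(j < q) 'X^j.

Lemma digit_series_quotient q m :
  digit_series q ^+ m * (1 - 'X) ^+ m = (1 - 'X^q) ^+ m.
Proof.
rewrite -exprMn; congr (_ ^+ _).
by rewrite -opprB mulrN mulrC -subrX1 opprB.
Qed.

Lemma coef_digit_series q m x : (0 < m)%N ->
  (digit_series q ^+ m)`_x = \sum_(i < m.+1) (-1) ^+ i * ('C(m, i))%:Z *
     binz (x%:Z - (i * q)%:Z + m%:Z - 1) (x%:Z - (i * q)%:Z).
Proof.
by move=> m_gt0; apply: coef_quotient_binz => // j _; rewrite digit_series_quotient.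
Qed.

(** * Counting exponents by digit sums *)

Section DigitCounts.
Context {q : nat}.
Hypothesis q_gt0 : (0 < q)%N.

Lemma sum_digit_series_compl :
  \sum_(j < q) 'X^(q - 1 - j) = digit_series q.
Proof.
rewrite /digit_series [RHS](reindex_inj rev_ord_inj); apply: eq_bigr => j _ /=.
by rewrite -subnDA.
Qed.

Lemma sum_qdigit_compl n u :
  (\sum_(i < n) (q - 1 - qdigit q i u) + wtq q n u = n * (q - 1))%N.
Proof.
rewrite /wtq -big_split /= (eq_bigr (fun=> q - 1)%N) ?sum_nat_const ?card_ord //.
by move=> i _; rewrite subnK // subn1 -ltnS prednK // ltn_mod.
Qed.

(* Complementing digits turns the weights at least n(q-1)-r into those at most r. *)
Lemma count_heavy n r :
  (\sum_(u < q ^ n) (n * (q - 1) <= wtq q n u + r)%N)%:Z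
    = \sum_(i < n.+1) (-1) ^+ i * ('C(n, i))%:Z *
        binz (n%:Z + r%:Z - (i * q)%:Z) (r%:Z - (i * q)%:Z).
Proof.
(* The factor [inv_series 1] has all coefficients 1, so it sums the coefficients of degree at most
   [r]; it also raises the exponent of [1 - X] to [n.+1]. *)
transitivity ((digit_series q ^+ n * @inv_series r.+1 1)`_r); last first.
  rewrite (@coef_quotient_binz q n n.+1) // => [|x lt_x].
    by apply: eq_bigr => i _; congr (_ * binz _ _); lia.
  rewrite -(mul1r ((1 - 'X^q) ^+ n)) -(eq_uptoM _ (@inv_seriesP r.+1 1)) //.
  by rewrite -digit_series_quotient exprS expr1; congr (polyseq _)`_x; ring.
have -> : digit_series q ^+ n =
    \sum_(u < q ^ n) 'X^(\sum_(i < n) (q - 1 - qdigit q i u)).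
  rewrite -sum_digit_series_compl -[in LHS](card_ord n) -prodr_const.
  rewrite -(@prod_sum_qdigit _ _ _ (fun _ j => 'X^(q - 1 - j))) //.
  by apply: eq_bigr => u _; rewrite -expr_sum.
rewrite mulr_suml coef_sum -natz natr_sum; apply: eq_bigr => u _.
rewrite coefXnM coef_poly -(sum_qdigit_compl n u) addnC leq_add2l.
case: leqP => // lecr; rewrite ifT ?ltnS ?leq_subr // addn1 /=.
by rewrite binn.
Qed.

Lemma card_odd_ord m b : (\sum_(i < 2 * m | odd i == b) 1 = m)%N.
Proof.
rewrite mul2n -addnn big_mkcond.
elim: m => [|m IHm]; first by rewrite big_ord0.
rewrite addSn addnS 2!big_ord_recr /= IHm addnn /= odd_double.
by case: b {IHm} => /=; lia.
Qed.

(** A bivariate generating function: the outer variable marks the [m] odd positions, the inner one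
    the [m] even positions. *)
Lemma count_odd_even m a b (n := (2 * m)%N) :
  (\sum_(u < q ^ n) ((Odig q n u == a) && (Edig q n u == b)))%:Z
    = (digit_series q ^+ m)`_a * (digit_series q ^+ m)`_b.
Proof.
pose F (i : 'I_n) j : {poly {poly int}} := if odd i then 'X^j else ('X^j)%:P.
have prod_half c (x : {poly {poly int}}) :
  \prod_(i < n | odd i == c) x = x ^+ m.
  by rewrite -(card_odd_ord m c) expr_sum.
have prodF (G : 'I_n -> {poly {poly int}}) : \prod_(i < n) G i =
  (\prod_(i < n | odd i == true) G i) * \prod_(i < n | odd i == false) G i.
  rewrite (bigID (fun i : 'I_n => odd i == true)) /=; congr (_ * _).
  by apply: eq_bigl => i; case: odd.
have : \sum_(u < q ^ n) \prod_(i < n) F i (qdigit q i u) =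
  map_poly polyC (digit_series q ^+ m) * (digit_series q ^+ m)%:P.
  rewrite prod_sum_qdigit // prodF !rmorphXn /=.
  rewrite -(prod_half true) -(prod_half false).
  congr (_ * _); apply: eq_bigr => i /eqP odd_i.
    rewrite rmorph_sum; apply: eq_bigr => j _.
    by rewrite /F odd_i /= map_polyXn.
  by rewrite rmorph_sum; apply: eq_bigr => j _; rewrite /F odd_i.
move/(congr1 (fun p : {poly {poly int}} => p`_a`_b)).
rewrite coefMC coef_map /= coefCM => <-.
rewrite !coef_sum -natz natr_sum; apply: eq_bigr => u _.
have -> : \prod_(i < n) F i (qdigit q i u) = 'X^(Odig q n u) * ('X^(Edig q n u))%:P.
  rewrite prodF /Odig /Edig !expr_sum rmorph_prod /=; congr (_ * _).
    by apply: eq_big => [i|i /eqP odd_i]; [case: odd | rewrite /F odd_i].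
  by apply: eq_big => [i|i /eqP odd_i]; [case: odd | rewrite /F odd_i].
rewrite coefMC coefXn mulr_natl coefMn coefXn [a == _]eq_sym [b == _]eq_sym.
by case: eqP; case: eqP.
Qed.
End DigitCounts.

(** The number of [m]-tuples of digits with sum [x], extended to integers since [(h - k) / 2] may be
    negative. *)
Definition restricted_compositions (q m : nat) (x : int) : int :=
  \sum_(i < m.+1) (-1) ^+ i * ('C(m, i))%:Z *
    binz (x - (i * q)%:Z + m%:Z - 1) (x - (i * q)%:Z).

Lemma restricted_compositions_lt0 q m x :
  x < 0 -> restricted_compositions q m x = 0.
Proof.
move=> x_lt0; rewrite /restricted_compositions big1 // => i _.
have : x - (i * q)%:Z < 0 by lia.
by case: (x - (i * q)%:Z) => // j _; rewrite mulr0.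
Qed.

Lemma wtq_odd_even q n u : wtq q n u = (Odig q n u + Edig q n u)%N.
Proof. by rewrite /wtq (bigID (fun i : 'I_n => odd i)). Qed.

(** The sum [h] and the difference [k] determine the pair of digit sums up to order: two ordered
    pairs for [k != 0], one for [k = 0]. *)
Lemma count_Theta q m r k (n := (2 * m)%N)
    (A := restricted_compositions q m) (h := (n * (q - 1))%:Z - r%:Z) :
  (0 < q)%N -> (0 < m)%N -> (r <= n * (q - 1))%N -> odd k = odd r ->
  (\sum_(u < q ^ n) inTheta q n r k u)%:Z
    = if k == 0%N then A (h %/ 2)%Z ^+ 2
      else 2 * (A ((h - k%:Z) %/ 2)%Z * A ((h + k%:Z) %/ 2)%Z).
Proof.
move=> q_gt0 m_gt0 le_r odd_k.
have AE x : (digit_series q ^+ m)`_x = A x%:Z by exact: coef_digit_series.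
have u_le (u : 'I_(q ^ n)) : (u <= q ^ n - 1)%N.
  by rewrite subn1 -ltnS prednK ?expn_gt0 ?q_gt0 ?ltn_ord.
(* If [h < k], both sides vanish. Otherwise equal parity makes the halving exact, and [b] is the
   smaller digit sum. *)
have [lt_hk|[b hb]] : h < k%:Z \/ exists b : nat, h = (k + 2 * b)%:Z.
  case: (ltrP h k%:Z) => le_kh; [by left | right].
  exists (n * (q - 1) - r - k)./2.
  have : odd (n * (q - 1) - r - k) = false.
    have ? : (r + k <= n * (q - 1))%N by rewrite /h in le_kh; lia.
    by rewrite -subnDA oddB // oddD odd_k addbb addbF oddM /n oddM.
  by rewrite /h in le_kh *; lia.
- rewrite big1 => [|u _].
    case: eqP => [k0|_]; first by rewrite /h in lt_hk; lia.
    rewrite [A ((h - _) %/ _)%Z]restricted_compositions_lt0 ?mul0r ?mulr0 //.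
    by lia.
  apply/eqP; rewrite eqb0; apply/negP => /and3P[_].
  by rewrite wtq_odd_even /h in lt_hk *; lia.
have inThetaE (u : 'I_(q ^ n)) : inTheta q n r k u =
    ((Odig q n u == b) && (Edig q n u == (b + k)%N)) ||
    ((Odig q n u == (b + k)%N) && (Edig q n u == b)) :> bool.
  rewrite /inTheta u_le wtq_odd_even /=; rewrite /h in hb.
  by move: (Odig _ _ _) (Edig _ _ _) => x y; lia.
case: eqP => [k0|k0].
  have -> : (h %/ 2)%Z = b%:Z by lia.
  rewrite expr2 -!AE -count_odd_even //; congr (Posz _).
  by apply: eq_bigr => u _; rewrite inThetaE k0 addn0 orbb.
have -> : ((h - k%:Z) %/ 2)%Z = b%:Z by lia.
have -> : ((h + k%:Z) %/ 2)%Z = (b + k)%:Z by lia.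
(* One copy of the product counts each order of the pair; the two cases exclude each other because
   [k != 0]. *)
rewrite -!AE mulr_natl mulr2n {2}mulrC -!count_odd_even // -PoszD -big_split.
congr (Posz _); apply: eq_bigr => u _; rewrite inThetaE /=.
by move: (Odig _ _ _) (Edig _ _ _) => x y; lia.
Qed.

(** * The zero set: decomposition, shift invariance and size *)

Lemma wtq0 q n : wtq q n 0 = 0%N.
Proof. by rewrite /wtq big1 // => i _; rewrite /qdigit div0n mod0n. Qed.

(** The pieces are disjoint: [Z_r] has weights strictly below [n(q-1) - r], and [|O(u) - E(u)|]
    fixes [k]. *)
Lemma inZrI_split q m r I u :
  inZrI q m r I u = (inZr q (2 * m) r u
   + \sum_(k < (m * (q - 1)).+1 | Ibar q m r I k) inTheta q (2 * m) r k u)%N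
  :> nat.
Proof.
have wt_Theta k : inTheta q (2 * m) r k u -> ~~ inZr q (2 * m) r u.
  by move=> /and3P[_ /eqP wu _]; rewrite /inZr -wu !negb_and addn1 ltnn !orbT.
rewrite /inZrI; case: existsP => [[k /andP[Ik uk]]|no_k].
  rewrite orbT (negPf (wt_Theta k uk)) (bigD1 k) //= uk big1 // => j /andP[_ jk].
  apply/eqP; rewrite eqb0; apply: contra jk.
  case/and3P: uk => _ _ uk /and3P[_ _ uj].
  by apply/eqP/val_inj => /=; lia.
rewrite orbF big1 ?addn0 // => k Ik; apply/eqP; rewrite eqb0.
by apply/negP => uk; apply: no_k; exists k; rewrite Ik.
Qed.

Section ZeroSetShift.
Context {q m r : nat} {I : pred nat}.
Hypotheses (q_gt0 : (0 < q)%N) (m_gt0 : (0 < m)%N).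
Local Notation n := (2 * m)%N.
Let n_gt0 : (0 < n)%N. Proof. by rewrite muln_gt0. Qed.

(** The shift swaps [O(u)] and [E(u)], while membership is symmetric in them. *)
Lemma inZrI_cyclic_shift u : (u < q ^ n)%N ->
  inZrI q m r I (cyclic_shift q n u) = inZrI q m r I u.
Proof.
move=> lt_u; set v := cyclic_shift q n u.
have lt_v : (v < q ^ n)%N by exact: cyclic_shift_lt.
have OE w : Odig q n w = (\sum_(i < n | odd i == true) qdigit q i w)%N.
  by apply: eq_bigl => i; case: odd.
have EE w : Edig q n w = (\sum_(i < n | odd i == false) qdigit q i w)%N.
  by apply: eq_bigl => i; case: odd.
have OEv : Odig q n v = Edig q n u by rewrite OE sum_parity_cyclic_shift // EE.
have EOv : Edig q n v = Odig q n u by rewrite EE sum_parity_cyclic_shift // OE.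
have wv : wtq q n v = wtq q n u by rewrite !wtq_odd_even OEv EOv addnC.
(* The shift fixes 0 and is injective, so it sends no positive exponent to 0. *)
have v_gt0 : (0 < v)%N = (0 < u)%N.
  have s0 : cyclic_shift q n 0 = 0%N :> nat by rewrite /cyclic_shift mod0n div0n.
  rewrite !lt0n; congr negb; apply/eqP/eqP => [v0|u0]; last by rewrite /v u0.
  apply: (cyclic_shift_inj q_gt0 n_gt0); rewrite ?inE ?expn_gt0 ?q_gt0 //.
  by rewrite -/v v0 s0.
have le_v : (v <= q ^ n - 1)%N = (u <= q ^ n - 1)%N by lia.
rewrite /inZrI /inZr /inTheta wv OEv EOv v_gt0 le_v; congr orb.
by apply: eq_existsb => k; rewrite orbC.
Qed.
End ZeroSetShift.

(** Each positive exponent is either light or heavy. Zero is neither: its weight 0 is below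
    [n(q-1) - r]. *)
Lemma count_inZr q n r : (0 < q)%N -> (r < n * (q - 1))%N ->
  (\sum_(u < q ^ n) inZr q n r u
    + \sum_(u < q ^ n) (n * (q - 1) <= wtq q n u + r) = q ^ n - 1)%N.
Proof.
move=> q_gt0 lt_r; have qn_gt0 : (0 < q ^ n)%N by rewrite expn_gt0 q_gt0.
rewrite -big_split /= -(big_mkord xpredT (fun u =>
  inZr q n r u + (n * (q - 1) <= wtq q n u + r) : nat)%N).
rewrite big_ltn // wtq0 add0n leqNgt lt_r /= add0n.
rewrite (@eq_big_nat _ _ _ _ _ _ (fun=> 1%N)) ?sum_nat_const_nat ?muln1 //.
by move=> u /andP[u_gt0 lt_u]; rewrite /inZr u_gt0; lia.
Qed.

Theorem theorem3p9 (p l m r : nat) (K : finFieldType) (L : fieldExtType K)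
  (alpha : L) (I : pred nat) :
  prime p -> #|K| = (p ^ l)%N -> (1 <= m)%N ->
  \dim {:L} = (2 * m)%N ->
  ((p ^ l) ^ (2 * m) - 1).-primitive_root alpha ->
  (r < 2 * m * (p ^ l - 1))%N ->
  (forall k, I k -> Mr (p ^ l) m r k) ->
  let q : nat := (p ^ l)%N in
  let n : nat := (2 * m)%N in
  let A (x : int) : int :=
    \sum_(i < m.+1) (-1) ^+ i * ('C(m, i))%:Z *
       binz (x - (i * q)%:Z + m%:Z - 1) (x - (i * q)%:Z) in
  let h : int := (n * (q - 1))%:Z - r%:Z in
  ((\dim (Cq q m r I alpha))%:Z : int) =
    \sum_(i < n.+1) (-1) ^+ i * ('C(n, i))%:Z *
       binz (n%:Z + r%:Z - (i * q)%:Z) (r%:Z - (i * q)%:Z)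
    - 2 * \sum_(k < (m * (q - 1)).+1 | Ibar q m r I k && (k != 0%N :> nat))
           A ((h - k%:Z) %/ 2)%Z * A ((h + k%:Z) %/ 2)%Z
    - (if Ibar q m r I 0 then A (h %/ 2)%Z ^+ 2 else 0).
Proof.
move=> pr_p cardK m_gt0 _ prim lt_r _ q n A h.
have q_gt0 : (0 < q)%N by rewrite expn_gt0 prime_gt0.
have qn_gt0 : (0 < q ^ n)%N by rewrite expn_gt0 q_gt0.
have n_gt0 : (0 < n)%N by rewrite muln_gt0.
have NS : (q ^ n - 1).+1 = (q ^ n)%N by rewrite subn1 prednK.
have Z0 : inZrI q m r I 0 = false.
  apply/orP => -[/andP[//]|/existsP[k /andP[_ /and3P[_]]]].
  by rewrite wtq0 add0n ltn_eqF.
have lt_u (u : 'I_(q ^ n - 1).+1) : (u < q ^ n)%N.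
  by apply: leq_trans (ltn_ord u) _; rewrite NS.
pose sg (u : 'I_(q ^ n - 1).+1) : 'I_(q ^ n - 1).+1 :=
  inord (cyclic_shift q n u).
have sgE u : sg u = cyclic_shift q n u :> nat.
  by rewrite inordK //; apply: leq_trans (cyclic_shift_lt q_gt0 n_gt0 _) _; rewrite ?NS.
have dimC : \dim (Cq q m r I alpha) =
    (q ^ n - 1 - \sum_(u < (q ^ n - 1).+1) inZrI q m r I u)%N.
  rewrite /Cq dim_extended_code (@dim_cyclic_code _ _ _ _ _ sg) ?Z0 //.
  - move=> u v /(congr1 val) /=; rewrite !sgE => uv; apply/val_inj.
    by apply: (cyclic_shift_inj q_gt0 n_gt0) uv; rewrite inE.
  - by move=> u; rewrite sgE inZrI_cyclic_shift.
  move=> u; rewrite sgE cardK; apply/eqP; rewrite (eq_prim_root_expr prim).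
  by apply/eqP; exact: cyclic_shift_mod.
(* This bound lets the truncated subtraction in [dimC] pass to the integers. *)
have le_Z : (\sum_(u < (q ^ n - 1).+1) inZrI q m r I u <= q ^ n - 1)%N.
  rewrite big_ord_recl /= Z0 add0n -[X in (_ <= X)%N]card_ord -sum1_card.
  by rewrite leq_sum // => i _; case: (inZrI _ _ _ _ _).
have countZ : (\sum_(u < q ^ n) inZrI q m r I u = \sum_(u < q ^ n) inZr q n r u
    + \sum_(k < (m * (q - 1)).+1 | Ibar q m r I k)
        \sum_(u < q ^ n) inTheta q n r k u)%N.
  rewrite exchange_big -big_split; apply: eq_bigr => u _.
  by rewrite inZrI_split.
rewrite dimC -subzn // (congr1 (fun N => (\sum_(u < N) _)%N) NS).
(* With [q ^ n - 1] split into light and heavy exponents, the light ones cancel against [Z_r]; the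
   heavy ones give the first sum. *)
rewrite -(count_heavy q_gt0) -{1}(count_inZr _ _ _ q_gt0 lt_r).
rewrite countZ !PoszD opprD addrACA subrr add0r -addrA -opprD; congr (_ - _).
have -> : (\sum_(k < (m * (q - 1)).+1 | Ibar q m r I k)
    \sum_(u < q ^ n) inTheta q n r k u)%N%:Z =
  \sum_(k < (m * (q - 1)).+1 | Ibar q m r I k)
    if k == 0%N :> nat then A (h %/ 2)%Z ^+ 2
    else 2 * (A ((h - k%:Z) %/ 2)%Z * A ((h + k%:Z) %/ 2)%Z).
  rewrite -natz natr_sum; apply: eq_bigr => k /andP[/andP[_ /eqP odd_k] _].
  by rewrite natz; apply: count_Theta => //; exact: ltnW.
(* The index [k = 0] is set apart, as its term is a square without the factor 2. *)
rewrite (bigID (fun k : 'I__ => k != 0%N :> nat)) /= mulr_sumr; congr (_ + _).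
  by apply: eq_bigr => k /andP[_ /negPf ->].
rewrite big_mkcond big_ord_recl /= andbT big1 ?addr0 // => k _.
by rewrite andbF.
Qed.
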